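(* Let $X,Y\in\mathbb{C}^{n,m}\setminus\{0\}$ and suppose that $M:=(X^*Y+Y^*X)^{-1}$ exists. Then $\mathbb{S}(X,Y)\neq\emptyset$ if and only if $X^*Y+Y^*X\succ 0$ and $YX^\dagger X=Y$. Moreover, if $\mathbb{S}(X,Y)\neq\emptyset$, then $$\mathbb{S}(X,Y)=\{H+\widetilde{H}(K,G,Z) : K,G,Z\in\mathbb{C}^{n,n},\ K\succeq 0,\ G^*=-G\},$$ where $$H:=\frac12\left(YX^\dagger-(X^\dagger)^*Y^*\right)+\frac12\Big\{YMY^*+YMX^*YX^\dagger+(YX^\dagger)^*XMY^*+(YX^\dagger)^*XMX^*YX^\dagger\Big\}$$ and $$\widetilde{H}(K,G,Z):=\frac12\Big(\mathcal{P}_XK\mathcal{P}_X+\mathcal{P}_XG\mathcal{P}_X-\mathcal{P}_XZ^*XX^\dagger+(X^\dagger)^*X^*Z\mathcal{P}_X+YMX^*Z\mathcal{P}_X+(YX^\dagger)^*XMX^*Z\mathcal{P}_X+\mathcal{P}_XZ^*XMY^*+\mathcal{P}_XZ^*XMX^*YX^\dagger+\mathcal{P}_XZ^*XMX^*Z\mathcal{P}_X\Big).$$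
   Context: For $X,Y\in\mathbb{C}^{n,m}$, $\mathbb{S}(X,Y):=\{\Delta\in\mathbb{C}^{n,n}:\Delta+\Delta^*\succeq 0,\ \Delta X=Y\}$ is the set of dissipative mappings from $X$ to $Y$. $A\succeq 0$ (resp. $A\succ 0$) means that $A$ is Hermitian positive semidefinite (resp. definite). $X^\dagger$ is the Moore-Penrose pseudoinverse of $X$ and $\mathcal{P}_X=I_n-XX^\dagger$. *)

(* Defs.v *)
From mathcomp Require Import all_boot all_order all_algebra.
From mathcomp Require Import sesquilinear spectral.
From mathcomp Require Import boolp classical_sets.

Set Implicit Arguments.
Unset Strict Implicit.
Unset Printing Implicit Defensive.

Import Order.TTheory GRing.Theory Num.Theory Num.Def.

Local Open Scope ring_scope.
Local Open Scope sesquilinear_scope.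
Local Open Scope classical_set_scope.

Section Definiteness.
Variables (C : numClosedFieldType) (n : nat).

(* In the partial order of C, 0 <= z and 0 < z entail that z is real. *)
Definition psdmx (A : 'M[C]_n) : Prop :=
  A \is hermsymmx /\ forall v : 'cV[C]_n, 0 <= (v^t* *m A *m v) 0 0.

Definition pdmx (A : 'M[C]_n) : Prop :=
  A \is hermsymmx /\ forall v : 'cV[C]_n, v != 0 -> 0 < (v^t* *m A *m v) 0 0.

End Definiteness.

Section MoorePenrose.
Variable C : numClosedFieldType.

Definition is_mpinv p q (A : 'M[C]_(p, q)) (B : 'M[C]_(q, p)) : Prop :=
  [/\ A *m B *m A = A, B *m A *m B = B,
      (A *m B)^t* = A *m B & (B *m A)^t* = B *m A].

(* The default value 0 is never used, by mpinvP. *)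
Definition mpinv p q (A : 'M[C]_(p, q)) : 'M[C]_(q, p) :=
  xget 0 [set B | is_mpinv A B].

Lemma ctmx_mul p q r (A : 'M[C]_(p, q)) (B : 'M[C]_(q, r)) :
  (A *m B)^t* = B^t* *m A^t*.
Proof. by rewrite trmx_mul map_mxM. Qed.

Lemma mulmx_ct_eq0 q (u : 'rV[C]_q) : u *m u^t* = 0 -> u = 0.
Proof.
move=> /matrixP/(_ 0 0); rewrite !mxE => u0; apply/rowP => j; rewrite mxE.
have u_ge0 i : true -> 0 <= u 0 i * (u^t*) i 0 by rewrite !mxE mul_conjC_ge0.
by have /eqP := psumr_eq0P u_ge0 u0 (i := j) isT; rewrite !mxE mul_conjC_eq0 => /eqP.
Qed.

Lemma row_free_gram_unit p q (B : 'M[C]_(p, q)) :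
  row_free B -> B *m B^t* \in unitmx.
Proof.
move=> fB; rewrite -row_free_unit -kermx_eq0; apply/eqP/row_matrixP => i.
rewrite row0; set v := row i _.
have v0 : v *m (B *m B^t*) = 0.
  by apply/sub_kermxP; rewrite /v row_sub.
apply/eqP; rewrite -(mulmx_free_eq0 v fB); apply/eqP/mulmx_ct_eq0.
by rewrite ctmx_mul mulmxA -[v *m B *m _]mulmxA v0 mul0mx.
Qed.

Lemma ctmx_inv p (A : 'M[C]_p) : A^t* = A -> (invmx A)^t* = invmx A.
Proof. by move=> hA; rewrite trmx_inv map_invmx hA. Qed.

Lemma is_mpinv_exists p q (A : 'M[C]_(p, q)) : exists B, is_mpinv A B.
Proof.
have [r [F [E [AE fF fE]]]] : exists r (F : 'M[C]_(p, r)) (E : 'M[C]_(r, q)),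
    [/\ A = F *m E, row_full F & row_free E].
  exists (\rank A), (col_base A), (row_base A).
  by rewrite mulmx_base row_base_free col_base_full.
have uE : E *m E^t* \in unitmx by rewrite row_free_gram_unit.
have uF : F^t* *m F \in unitmx.
  have := @row_free_gram_unit _ _ (F^t*); rewrite trmxCK; apply.
  by rewrite /row_free mxrank_map mxrank_tr.
pose U := invmx (E *m E^t*); pose V := invmx (F^t* *m F).
have hU : U^t* = U by apply: ctmx_inv; rewrite ctmx_mul trmxCK.
have hV : V^t* = V by apply: ctmx_inv; rewrite ctmx_mul trmxCK.
have AB : A *m (E^t* *m U *m V *m F^t*) = F *m V *m F^t*.
  rewrite AE !mulmxA -[F *m E *m _]mulmxA -[F *m _ *m U]mulmxA.
  by rewrite mulmxV // mulmx1.
have BA : (E^t* *m U *m V *m F^t*) *m A = E^t* *m U *m E.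
  rewrite AE !mulmxA -[_ *m F^t* *m F]mulmxA -[_ *m V *m _]mulmxA.
  by rewrite mulVmx // mulmx1.
exists (E^t* *m U *m V *m F^t*); split; rewrite ?AB ?BA.
- rewrite {1}AE !mulmxA -[_ *m F^t* *m F]mulmxA -[F *m V *m _]mulmxA.
  by rewrite mulVmx // mulmx1 -AE.
- rewrite !mulmxA -[_ *m E *m E^t*]mulmxA -[_ *m U *m (E *m _)]mulmxA.
  by rewrite mulVmx // mulmx1.
- by rewrite !ctmx_mul trmxCK hV mulmxA.
- by rewrite !ctmx_mul trmxCK hU mulmxA.
Qed.

Lemma mpinvP p q (A : 'M[C]_(p, q)) : is_mpinv A (mpinv A).
Proof. by have [B AB] := is_mpinv_exists A; exact: (xgetI _ AB). Qed.

Lemma is_mpinv_uniq p q (A : 'M[C]_(p, q)) (B D : 'M[C]_(q, p)) :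
  is_mpinv A B -> is_mpinv A D -> B = D.
Proof.
move=> [B1 B2 B3 B4] [D1 D2 D3 D4].
have eAB : A *m B = A *m D.
  by rewrite -B3 -{1}D1 -mulmxA ctmx_mul B3 D3 mulmxA B1.
have eBA : B *m A = D *m A.
  by rewrite -B4 -{1}D1 -[A *m D *m A]mulmxA mulmxA ctmx_mul B4 D4 -mulmxA
             [A *m (B *m A)]mulmxA B1.
by rewrite -B2 -mulmxA eAB mulmxA eBA D2.
Qed.

End MoorePenrose.

Section DissipativeMappings.
Variables (C : numClosedFieldType) (n m : nat) (X Y : 'M[C]_(n, m)).

Definition dissipative_mappings : set 'M[C]_n :=
  [set D | psdmx (D + D^t*) /\ D *m X = Y].

Definition compl_proj : 'M[C]_n := 1%:M - X *m mpinv X.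

Local Notation P := compl_proj.
Local Notation M := (invmx (X^t* *m Y + Y^t* *m X)).

Definition dissH : 'M[C]_n :=
  2^-1 *: (Y *m mpinv X - (mpinv X)^t* *m Y^t*)
  + 2^-1 *: (Y *m M *m Y^t*
             + Y *m M *m X^t* *m Y *m mpinv X
             + (Y *m mpinv X)^t* *m X *m M *m Y^t*
             + (Y *m mpinv X)^t* *m X *m M *m X^t* *m Y *m mpinv X).

Definition dissHtilde (K G Z : 'M[C]_n) : 'M[C]_n :=
  2^-1 *: (P *m K *m P
           + P *m G *m P
           - P *m Z^t* *m X *m mpinv X
           + (mpinv X)^t* *m X^t* *m Z *m P
           + Y *m M *m X^t* *m Z *m P
           + (Y *m mpinv X)^t* *m X *m M *m X^t* *m Z *m P
           + P *m Z^t* *m X *m M *m Y^t*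
           + P *m Z^t* *m X *m M *m X^t* *m Y *m mpinv X
           + P *m Z^t* *m X *m M *m X^t* *m Z *m P).

End DissipativeMappings.

(* Main.v *)
Require Import Defs.
From mathcomp Require Import all_boot all_order all_algebra.
From mathcomp Require Import sesquilinear spectral complex.
From mathcomp Require Import boolp classical_sets reals.
From mathcomp Require Import ring.

Set Implicit Arguments.
Unset Strict Implicit.
Unset Printing Implicit Defensive.

Import Order.TTheory GRing.Theory Num.Theory Num.Def.

Local Open Scope ring_scope.
Local Open Scope sesquilinear_scope.
Local Open Scope classical_set_scope.

(** Write A^H for the conjugate transpose of A, X^+ for the pseudoinverse of X,
    P for the projector 1 - X X^+, S for X^H Y + Y^H X, and M for its
    inverse.  The idea is to separate the Hermitian and skew-Hermitian parts of
    H + Htilde, which is half of F M F^H + P K P + L with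
    F = Y + (X^+)^H Y^H X + P Z^H X ([diss_factor]) and L skew-Hermitian
    ([diss_skew]); see [dissHHtildeE].

    If D is dissipative with D X = Y, then S = X^H (D + D^H) X is positive
    semidefinite, hence definite as it is invertible ([psdmx_unit_pdmx]), and
    Y X^+ X = D X X^+ X = Y.  Conversely, Y X^+ X = Y and the invertibility of S
    force X^+ X = 1, so that F^H X = S and L X = Y + Y - F.  Then
    F M F^H X = F, which gives (H + Htilde) X = Y, while twice the Hermitian part,
    F M F^H + P K P, is semidefinite because M is: every member of the family is
    a solution ([dissHHtilde_dissipative]), and K = G = Z = 0 gives existence.

    The family is exhaustive ([dissipative_param]) by a Schur complement
    argument.  For a solution D, let A = D + D^H; then
    A = (A X) M (A X)^H + K, where K is semidefinite ([psdmx_schur]) and kills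
    the range of X, so K = P K P.  With Z = D one finds F = A X
    ([dissipative_factor]), and with G = D - D^H one finds L = D - D^H
    ([corner_identity]), so the parameters K, G, Z give back D. *)

(** * Positive semidefinite matrices *)

Section PositiveSemidefinite.
Variable C : numClosedFieldType.

Lemma ctmxD p q (A B : 'M[C]_(p, q)) : (A + B)^t* = A^t* + B^t*.
Proof. by rewrite linearD map_mxD. Qed.

Lemma ctmxN p q (A : 'M[C]_(p, q)) : (- A)^t* = - A^t*.
Proof. by rewrite linearN map_mxN. Qed.

Lemma ctmxB p q (A B : 'M[C]_(p, q)) : (A - B)^t* = A^t* - B^t*.
Proof. by rewrite ctmxD ctmxN. Qed.

Lemma ctmx1 p : (1%:M : 'M[C]_p)^t* = 1%:M.
Proof. by rewrite trmx1 map_mx1. Qed.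

Lemma scale_half p q (A : 'M[C]_(p, q)) : 2^-1 *: (A + A) = A.
Proof. by rewrite -mulr2n -scaler_nat scalerA mulVf ?pnatr_eq0 // scale1r. Qed.

Lemma ctmx_scale_half p q (A : 'M[C]_(p, q)) : (2^-1 *: A)^t* = 2^-1 *: A^t*.
Proof. by rewrite linearZ /= map_mxZ fmorphV rmorph_nat. Qed.

Lemma hermsymmxP p (A : 'M[C]_p) : reflect (A^t* = A) (A \is hermsymmx).
Proof.
apply: (iffP (is_hermitianmxP _ _ _)); rewrite expr0 scale1r => hA;
  exact: esym hA.
Qed.

Lemma psdmxD p (A B : 'M[C]_p) : psdmx A -> psdmx B -> psdmx (A + B).
Proof.
move=> [/hermsymmxP hA A0] [/hermsymmxP hB B0]; split.
  by apply/hermsymmxP; rewrite ctmxD hA hB.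
by move=> v; rewrite mulmxDr mulmxDl mxE addr_ge0.
Qed.

Lemma psdmx_congr p q (A : 'M[C]_p) (B : 'M[C]_(q, p)) :
  psdmx A -> psdmx (B *m A *m B^t*).
Proof.
move=> [/hermsymmxP hA A0]; split.
  by apply/hermsymmxP; rewrite !ctmx_mul trmxCK hA mulmxA.
by move=> v; have := A0 (B^t* *m v); rewrite ctmx_mul trmxCK !mulmxA.
Qed.

(** An isotropic vector [v] is a minimizer of the form, so its gradient
    [A *m v] must vanish; the proof evaluates the form at a
    point reached from [v] by moving against that gradient. *)
Lemma psdmx_form_eq0 p (A : 'M[C]_p) (v : 'cV[C]_p) :
  psdmx A -> (v^t* *m A *m v) 0 0 = 0 -> A *m v = 0.
Proof.
move=> [/hermsymmxP hA A0] v0; set w := A *m v.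
have wE : w^t* = v^t* *m A by rewrite ctmx_mul hA.
pose a := (w^t* *m w) 0 0; pose b := (w^t* *m A *m w) 0 0.
have a0 : 0 <= a.
  by rewrite /a mxE sumr_ge0 // => i _; rewrite !mxE mulrC mul_conjC_ge0.
have b0 : 0 <= b by exact: A0.
have ca : a^* = a by apply/CrealP/ger0_real.
have cb : (b + 1)^* = b + 1 by apply/CrealP/ger0_real/addr_ge0.
(* This is a positive multiple of v - (a / (b + 1)) w; there the form equals
   - a ^+ 2 * (b + 2), and its nonnegativity forces a = 0. *)
have := A0 ((b + 1) *: v - a *: w).
have -> : (((b + 1) *: v - a *: w)^t* *m A *m ((b + 1) *: v - a *: w)) 0 0
          = - (a ^+ 2 * (b + 2)).
  have -> : ((b + 1) *: v - a *: w)^t* = (b + 1) *: v^t* - a *: w^t*.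
    by rewrite ctmxB !linearZ /= !map_mxZ /= ca cb scalerN.
  have e0 : (w^t* *m v) 0 0 = 0 by rewrite wE.
  have aE : (w^t* *m w) 0 0 = a by [].
  have aE' : (w^t* *m A *m v) 0 0 = a by rewrite -mulmxA.
  have bE : (w^t* *m A *m w) 0 0 = b by [].
  rewrite !mulmxBl !mulmxBr -!scalemxAl -!scalemxAr -wE.
  move: e0 aE aE' bE; clearbody a b.
  move: (w^t* *m v) (w^t* *m w) (w^t* *m A *m v) (w^t* *m A *m w).
  by move=> e q q' r; rewrite !mxE => -> -> -> ->; ring.
have b2 : 0 < b + 2 by rewrite ltr_wpDl.
rewrite oppr_ge0 pmulr_lle0 // => a2_le0.
have /eqP : a ^+ 2 = 0 by apply/le_anti; rewrite a2_le0 exprn_ge0.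
rewrite sqrf_eq0 => /eqP aE0.
rewrite -[w]trmxCK (mulmx_ct_eq0 (u := w^t*)) ?trmx0 ?map_mx0 //.
by apply/matrixP => i j; rewrite !ord1 trmxCK [RHS]mxE.
Qed.

Lemma psdmx_unit_pdmx p (A : 'M[C]_p) :
  psdmx A -> A \in unitmx -> pdmx A.
Proof.
move=> psdA uA; have [hA A0] := psdA; split=> // v v_neq0.
rewrite lt_neqAle A0 andbT eq_sym; apply: contraNneq v_neq0 => v0.
by rewrite -[v](mulKmx uA) (psdmx_form_eq0 psdA v0) mulmx0.
Qed.

Lemma pdmx_psdmx p (A : 'M[C]_p) : pdmx A -> psdmx A.
Proof.
move=> [hA A0]; split=> // v; have [->|/A0/ltW //] := eqVneq v 0.
by rewrite mulmx0 mxE.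
Qed.

Lemma psdmx_inv p (A : 'M[C]_p) :
  A \in unitmx -> psdmx A -> psdmx (invmx A).
Proof.
move=> uA psdA; have [/hermsymmxP hA _] := psdA.
have := psdmx_congr (invmx A) psdA.
by rewrite ctmx_inv // mulVmx // mul1mx.
Qed.

(** The generalized Schur complement is a congruence transform of [A]: with
    N := [invmx (B^t* *m A *m B)], it equals T A T^H for
    T := 1 - A B N B^H, because N (B^H A B) N = N. *)
Lemma psdmx_schur p q (A : 'M[C]_p) (B : 'M[C]_(p, q)) :
  psdmx A -> B^t* *m A *m B \in unitmx ->
  psdmx (A - A *m B *m invmx (B^t* *m A *m B) *m B^t* *m A).
Proof.
move=> psdA; have [/hermsymmxP hA _] := psdA.
set S := _ *m B => uS; set M := invmx S.
have hM : M^t* = M by apply: ctmx_inv; rewrite /S !ctmx_mul trmxCK hA mulmxA.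
have := psdmx_congr (1%:M - A *m B *m M *m B^t*) psdA.
rewrite ctmxB ctmx1 !ctmx_mul trmxCK hM hA !mulmxBl !mulmxBr !mulmx1 !mul1mx.
rewrite !mulmxA.
suff -> : A *m B *m M *m B^t* *m A *m B *m M *m B^t* *m A
          = A *m B *m M *m B^t* *m A by rewrite subrr subr0.
have -> : A *m B *m M *m B^t* *m A *m B *m M = A *m B *m (M *m S *m M).
  by rewrite /S !mulmxA.
by rewrite mulVmx // mul1mx.
Qed.

(** With D^H for [E] and the orthogonal projector onto the range of X for
    [Q], this recovers the skew part of D from its corners: [D *m Q] fixes what
    D does on the range of X, and the choice Z = D, G = D - D^H supplies the
    other corners.  The cancellation is formal. *)
Lemma corner_identity n (Q D E : 'M[C]_n) :
  D *m Q - Q *m E + (1%:M - Q) *m (D - E) *m (1%:M - Q)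
  - (1%:M - Q) *m E *m Q + Q *m D *m (1%:M - Q) = D - E.
Proof.
have mulP (A : 'M[C]_n) : A *m (1%:M - Q) = A - A *m Q by rewrite mulmxBr mulmx1.
have Pmul (A : 'M[C]_n) : (1%:M - Q) *m A = A - Q *m A by rewrite mulmxBl mul1mx.
rewrite !mulP !Pmul !(mulmxBr, mulmxBl) !(opprD, opprK) !addrA.
(* The reordering puts each term next to its opposite, after D - E. *)
by rewrite [LHS](ACl (3*4*1*7*6*2*13*5*8*11*9*14*12*10)%AC) /= -!/(_ + _)%R !addrK.
Qed.

End PositiveSemidefinite.

(** * The parametrized family H + Htilde *)

Section Dissipative.
Variables (C : numClosedFieldType) (n m : nat) (X Y : 'M[C]_(n, m)).

Local Notation Xp := (mpinv X).
Local Notation P := (compl_proj X).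
Local Notation S := (X^t* *m Y + Y^t* *m X).
Local Notation M := (invmx S).

(** The factor F for which twice the Hermitian part of H + Htilde is
    F M F^H + P K P.  For a dissipative D mapping X to Y, one has
    F = (D + D^H) X when Z = D (see [dissipative_factor]). *)
Definition diss_factor (Z : 'M[C]_n) : 'M[C]_(n, m) :=
  Y + Xp^t* *m Y^t* *m X + P *m Z^t* *m X.

(** Twice the skew-Hermitian part of H + Htilde when G is skew-Hermitian:
    [mpinv X]^H X^H is the projector onto the range of X, so the two terms in Z
    are exchanged, up to sign, by conjugate transposition. *)
Definition diss_skew (G Z : 'M[C]_n) : 'M[C]_n :=
  Y *m Xp - Xp^t* *m Y^t* + P *m G *m P
  - P *m Z^t* *m X *m Xp + Xp^t* *m X^t* *m Z *m P.

Lemma compl_projX : P *m X = 0.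
Proof. by have [XX _ _ _] := mpinvP X; rewrite mulmxBl mul1mx XX subrr. Qed.

Lemma ctmx_compl_proj : P^t* = P.
Proof. by have [_ _ hX _] := mpinvP X; rewrite ctmxB ctmx1 hX. Qed.

(** The nine products containing M in H and Htilde are the expansion of
    F M F^H, where F has three summands; this splitting makes both
    semidefiniteness and the interpolation condition visible. *)
Lemma dissHHtildeE (K G Z : 'M[C]_n) :
  dissH X Y + dissHtilde X Y K G Z =
  2^-1 *: (diss_factor Z *m M *m (diss_factor Z)^t* + P *m K *m P
           + diss_skew G Z).
Proof.
rewrite /dissH /dissHtilde /diss_factor /diss_skew -!scalerDr.
congr (_ *: _).
(* P is made opaque, so that it is not expanded into 1 - X X^+ below. *)
move: ctmx_compl_proj; move: P => Q hQ.
rewrite !ctmxD !ctmx_mul !trmxCK hQ !mulmxDl !mulmxDr !mulmxA !addrA.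
by rewrite [LHS](ACl (3*4*11*5*6*12*13*14*15*7*1*2*8*9*10)%AC).
Qed.

Lemma ctmx_diss_skew G Z : G^t* = - G -> (diss_skew G Z)^t* = - diss_skew G Z.
Proof.
move=> hG; rewrite /diss_skew; move: ctmx_compl_proj; move: P => Q hQ.
rewrite !(ctmxD, ctmxN, ctmx_mul) !trmxCK hQ hG.
rewrite !(mulmxA, mulmxN, mulNmx) !opprD !opprK.
by rewrite [LHS](ACl (2*1*3*5*4)%AC).
Qed.

(** X and Y, hence S, absorb [Xp *m X] on the right, and S is cancellable:
    so X has full column rank. *)
Lemma mpinv_mul_left_inv : S \in unitmx -> Y *m Xp *m X = Y -> Xp *m X = 1%:M.
Proof.
move=> uS YX; have [XX _ _ _] := mpinvP X.
suff SX : S *m (Xp *m X) = S by rewrite -[LHS](mulKmx uS) SX mulVmx.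
by rewrite mulmxDl -!mulmxA [X *m _]mulmxA XX [Y *m _]mulmxA YX.
Qed.

Lemma ctmx_diss_factorX Z : Xp *m X = 1%:M -> (diss_factor Z)^t* *m X = S.
Proof.
move=> XpX; rewrite /diss_factor.
move: compl_projX ctmx_compl_proj; move: P => Q QX hQ.
rewrite !(ctmxD, ctmx_mul) !trmxCK hQ !mulmxDl -!mulmxA.
by rewrite QX XpX !mulmx0 mulmx1 addr0 addrC.
Qed.

Lemma diss_skewX G Z :
  Xp *m X = 1%:M -> diss_skew G Z *m X = Y + Y - diss_factor Z.
Proof.
move=> XpX; rewrite /diss_factor /diss_skew.
move: compl_projX; move: P => Q QX.
rewrite !(mulmxDl, mulNmx) -!mulmxA QX XpX !mulmx0 !mulmx1.
rewrite !addr0 !opprD !addrA.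
by rewrite addrK !mulmxA.
Qed.

(** D + D^H is F M F^H + P K P, which is semidefinite because M is; and D X = Y
    because F M (F^H X) = F M S = F cancels against the term - F contributed by
    the skew part, leaving half of Y + Y. *)
Lemma dissHHtilde_dissipative (K G Z : 'M[C]_n) :
    psdmx S -> S \in unitmx -> Xp *m X = 1%:M -> psdmx K -> G^t* = - G ->
  dissipative_mappings X Y (dissH X Y + dissHtilde X Y K G Z).
Proof.
move=> psdS uS XpX psdK hG; rewrite dissHHtildeE.
set F := diss_factor Z; set T := F *m M *m F^t* + P *m K *m P.
have psdT : psdmx T.
  apply: psdmxD; first exact/psdmx_congr/psdmx_inv.
  by rewrite -[X in _ *m X]ctmx_compl_proj; apply: psdmx_congr.
have [/hermsymmxP hT _] := psdT; split.
  rewrite ctmx_scale_half ctmxD hT ctmx_diss_skew // -scalerDr addrACA subrr.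
  by rewrite addr0 scale_half.
rewrite -scalemxAl mulmxDl diss_skewX // /T mulmxDl -!mulmxA compl_projX.
rewrite ctmx_diss_factorX // !mulmx0 addr0 mulVmx // mulmx1.
by rewrite addrC subrK scale_half.
Qed.

(** * Necessary conditions and completeness of the parametrization *)

Lemma dissipative_gram D :
  D *m X = Y -> X^t* *m (D + D^t*) *m X = S.
Proof. by move=> <-; rewrite ctmx_mul mulmxDr mulmxDl !mulmxA. Qed.

Lemma dissipative_gram_psd D : dissipative_mappings X Y D -> psdmx S.
Proof.
move=> [psdA DX]; rewrite -(dissipative_gram DX).
by have := psdmx_congr (X^t*) psdA; rewrite trmxCK.
Qed.

Lemma dissipative_mpinv D : dissipative_mappings X Y D -> Y *m Xp *m X = Y.
Proof.
by move=> [_ <-]; have [XX _ _ _] := mpinvP X; rewrite -!mulmxA [X *m _]mulmxA XX.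
Qed.

Lemma dissipative_factor D :
  D *m X = Y -> (D + D^t*) *m X = diss_factor D.
Proof.
move=> DX; have [_ _ hX _] := mpinvP X.
have XpY : Xp^t* *m Y^t* *m X = X *m Xp *m D^t* *m X.
  by rewrite -DX ctmx_mul -hX ctmx_mul !mulmxA.
by rewrite /diss_factor XpY !mulmxBl mul1mx mulmxDl DX addrA addrAC addrK.
Qed.

(** Put A := D + D^H.  Since X^H A X = S is invertible, A splits as
    (A X) M (A X)^H + K with K its Schur complement relative to the range of X.
    K vanishes on that range, so K = P K P, and A X is the factor F for Z = D;
    the skew part is reproduced by G = D - D^H. *)
Lemma dissipative_param D :
    S \in unitmx -> dissipative_mappings X Y D ->
  exists K G Z : 'M[C]_n,
    [/\ psdmx K, G^t* = - G & D = dissH X Y + dissHtilde X Y K G Z].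
Proof.
move=> uS dD; have [psdA DX] := dD; have [/hermsymmxP hA _] := psdA.
have [_ _ hX _] := mpinvP X.
set A := D + D^t* in psdA hA.
have SE : X^t* *m A *m X = S := dissipative_gram DX.
pose K := A - A *m X *m M *m X^t* *m A.
have psdK : psdmx K.
  by rewrite /K -SE; apply: psdmx_schur => //; rewrite SE.
have [/hermsymmxP hK _] := psdK.
have KX : K *m X = 0.
  rewrite /K mulmxBl -!mulmxA [X^t* *m (A *m X)]mulmxA SE mulVmx // mulmx1.
  by rewrite subrr.
have KP : K *m P = K by rewrite mulmxBr mulmx1 mulmxA KX mul0mx subr0.
have PK : P *m K = K by rewrite -{1}hK -ctmx_compl_proj -ctmx_mul KP hK.
exists K, (D - D^t*), D; split=> //.
  by rewrite ctmxB trmxCK opprB.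
rewrite dissHHtildeE PK KP -(dissipative_factor DX) -/A.
rewrite ctmx_mul hA mulmxA [X in X + _](_ : _ = A); last first.
  by rewrite /K addrC subrK.
suff -> : diss_skew (D - D^t*) D = D - D^t*.
  by rewrite addrACA subrr addr0 scale_half.
have hXp : Xp^t* *m X^t* = X *m Xp by rewrite -ctmx_mul.
rewrite /diss_skew -DX -[P *m _ *m X *m _]mulmxA ctmx_mul mulmxA hXp -mulmxA.
exact: corner_identity.
Qed.

End Dissipative.

Theorem theorem4p1 (R : realType) (n m : nat) (X Y : 'M[R[i]]_(n, m))
    (X_neq0 : X != 0) (Y_neq0 : Y != 0)
    (M_exists : X^t* *m Y + Y^t* *m X \in unitmx) :
  (dissipative_mappings X Y !=set0 <->
     pdmx (X^t* *m Y + Y^t* *m X) /\ Y *m mpinv X *m X = Y) /\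
  (dissipative_mappings X Y !=set0 ->
     dissipative_mappings X Y =
       [set D | exists K G Z : 'M[R[i]]_n,
          [/\ psdmx K, G^t* = - G &
              D = dissH X Y + dissHtilde X Y K G Z]]).
Proof.
have psdmx0 : psdmx (0 : 'M[R[i]]_n).
  split; first by apply/hermsymmxP; rewrite trmx0 map_mx0.
  by move=> v; rewrite mulmx0 mul0mx mxE.
split; first split.
- move=> [D dD]; split; last exact: dissipative_mpinv dD.
  exact: psdmx_unit_pdmx (dissipative_gram_psd dD) M_exists.
- move=> [/pdmx_psdmx psdS YX]; exists (dissH X Y + dissHtilde X Y 0 0 0).
  apply: dissHHtilde_dissipative => //; first exact: mpinv_mul_left_inv M_exists YX.
  by rewrite trmx0 map_mx0 oppr0.
- move=> [D0 dD0]; apply/seteqP; split=> [D|_ [K [G [Z [psdK hG ->]]]]].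
    exact: dissipative_param.
  apply: dissHHtilde_dissipative => //; first exact: dissipative_gram_psd dD0.
  exact: mpinv_mul_left_inv M_exists (dissipative_mpinv dD0).
Qed.
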